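(* Let $\mathcal{G}=(\mathcal{V},\mathcal{E})$ be a digraph on $n>1$ nodes, and fix activation probabilities $p_{ij}$ and updating weights $w_{ij}$ as in the context. Then $\mathcal{G}$ is strongly connected if and only if there exists $\bar\epsilon>0$ such that for every $\epsilon\in(0,\bar\epsilon)$ the gossip algorithm with parameter $\epsilon$ achieves mean-square average consensus.
   Context: Setting: $\mathcal{V}=\{1,\dots,n\}$, $n>1$, and $\mathcal{G}$ has no selfloops. An edge $(j,i)$ means that $j$ sends to $i$. To each edge $(j,i)\in\mathcal{E}$ are assigned a probability $p_{ij}\in(0,1)$, with $\sum_{(j,i)\in\mathcal{E}}p_{ij}=1$, and an updating weight $w_{ij}\in(0,1)$. Gossip algorithm with parameter $\epsilon>0$: at each time $k\in\mathbb{Z}_+$, exactly one edge is activated. The choice is independent of the past, and edge $(j,i)$ is activated with probability $p_{ij}$. If $(j,i)$ is activated, then $$x_i(k+1)=x_i(k)+w_{ij}(x_j(k)-x_i(k))+\epsilon w_{ij}s_i(k),\qquad s_i(k+1)=s_i(k)+s_j(k)-(x_i(k+1)-x_i(k)),$$ $$x_j(k+1)=x_j(k),\qquad s_j(k+1)=0,$$ and $x_l(k+1)=x_l(k)$, $s_l(k+1)=s_l(k)$ for every other node $l$. The initial condition is $s(0)=0$ with $x(0)\in\mathbb{R}^n$ arbitrary (deterministic). Mean-square average consensus: for every $x(0)$, $E[\|x(k)-x_a\mathbf{1}\|_2^2]\to0$ and $E[\|s(k)\|_2^2]\to0$ as $k\to\infty$, where $x_a=\mathbf{1}^Tx(0)/n$.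 *)

(* Defs.v *)
From HB Require Import structures.
From mathcomp Require Import all_boot all_order all_algebra.
From mathcomp Require Import all_classical all_reals topology normedtype sequences.
Set Implicit Arguments. Unset Strict Implicit. Unset Printing Implicit Defensive.
Import Order.TTheory GRing.Theory Num.Theory.
Import numFieldNormedType.Exports.
Local Open Scope classical_set_scope.
Local Open Scope ring_scope.

(* A digraph on nodes 'I_n is an edge relation E : rel 'I_n ;
   E j i  means the edge (j,i) is present: j sends to i.
   Parameters p i j = p_{ij}, w i j = w_{ij} for the edge (j,i).
   States are pairs (x, s) of functions 'I_n -> R.
   An edge is encoded as the pair (j, i). *)

Section Gossip.
Variables (R : realType) (n : nat).
Definition state := (('I_n -> R) * ('I_n -> R))%type.

Definition gossip_step (w : 'I_n -> 'I_n -> R) (eps : R)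
    (e : 'I_n * 'I_n) (st : state) : state :=
  let j := e.1 in let i := e.2 in
  let x := st.1 in let s := st.2 in
  let xi' := x i + w i j * (x j - x i) + eps * w i j * s i in
  ((fun l => if l == i then xi' else x l),
   (fun l => if l == i then s i + s j - (xi' - x i)
             else if l == j then 0 else s l)).

Definition gossip_run w eps (t : seq ('I_n * 'I_n)) (st : state) : state :=
  foldl (fun st e => gossip_step w eps e st) st t.

Definition edge_prob (E : rel 'I_n) (p : 'I_n -> 'I_n -> R) (e : 'I_n * 'I_n) : R :=
  if E e.1 e.2 then p e.2 e.1 else 0.

(* Expectation of f(state at time k), edges chosen i.i.d. with edge_prob,
   starting from x(0) = x0, s(0) = 0. *)
Definition gossip_expect E p w eps (x0 : 'I_n -> R) (k : nat) (f : state -> R) : R :=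
  \sum_(t : k.-tuple ('I_n * 'I_n))
     (\prod_(e <- t) edge_prob E p e) * f (gossip_run w eps t (x0, fun _ => 0)).

Definition sqnorm (v : 'I_n -> R) : R := \sum_(l < n) v l ^+ 2.

Definition xavg (x0 : 'I_n -> R) : R := (\sum_(l < n) x0 l) / n%:R.

Definition ms_average_consensus E p w eps : Prop :=
  forall x0 : 'I_n -> R,
    (fun k => gossip_expect E p w eps x0 k
                (fun st => sqnorm (fun l => st.1 l - xavg x0))) @ \oo --> (0 : R)
    /\
    (fun k => gossip_expect E p w eps x0 k (fun st => sqnorm st.2)) @ \oo --> (0 : R).

Definition strongly_connected (E : rel 'I_n) : Prop := forall u v, connect E u v.
End Gossip.

(* Main.v *)
Require Import Defs.
From HB Require Import structures.
From mathcomp Require Import all_boot all_order all_algebra.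
From mathcomp Require Import all_classical all_reals topology normedtype sequences.
From mathcomp Require Import ring lra.
Set Implicit Arguments. Unset Strict Implicit. Unset Printing Implicit Defensive.
Import Order.TTheory GRing.Theory Num.Theory.
Import numFieldNormedType.Exports.
Local Open Scope ring_scope.

(* Sufficiency.  Recentre the values at [x_a]: then [\sum_l x l = - S] where [S] is
   the total surplus.  At [eps = 0] the form [\sum_l v l * x l ^+ 2], with [v] the
   stationary distribution of the averaging dynamics, loses a Dirichlet form of
   [x] at each step, while [s] is transported by coalescing random walks.  For
   [eps > 0] the surplus [s k] moreover feeds the [v]-mean of [x] at a mean rate
   [eps * a k] with [a > 0].  If [h] solves the Poisson equation
   [a = alpha + generator h] of the surplus walk, then [alpha > 0] and the
   corrected values [y l = x l - eps * (h . s)] gain [eps * alpha * S] in mean,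
   whatever the distribution of the surplus.  Since their [v]-mean is close to
   [- S / n], the form [\sum_l v l * y l ^+ 2] also loses
   [2 * eps * alpha / n * S ^+ 2].  A multiple of [eps * U], where [U] is the energy
   of the coalescing transport, dissipates [eps * |s| ^+ 2] up to
   [eps * S ^+ 2].  With [r] the spread of [x] and [t = |s|], the remaining errors
   are [O(eps * (r + eps * t) * (t + r + eps * t))], which the dissipated
   [r ^+ 2 + eps * t ^+ 2] absorbs for small [eps].

   Necessity.  If some node is not reachable from [u], start from the indicator
   of the nodes reachable from [u]: the others keep [x = s = 0] forever. *)

Lemma injective_endomorphism_surjective (K : fieldType) (V : vectType K)
    (F : {linear V -> V}) :
  (forall x, F x = 0 -> x = 0) -> forall y, exists x, F x = y.
Proof.
move=> F_inj y.
have kerF : lker (linfun F) == 0%VS.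
  rewrite -subv0; apply/subvP => x; rewrite memv_ker lfunE /= => /eqP/F_inj ->.
  exact: mem0v.
have /memv_imgP[x _ ->] : y \in limg (linfun F) by rewrite lker0_limgf// memvf.
by exists x; rewrite lfunE.
Qed.

Lemma connect_ind (T : finType) (r : rel T) (Q : T -> Prop) x y :
  (forall u v, r u v -> Q u -> Q v) -> connect r x y -> Q x -> Q y.
Proof.
move=> rQ /connectP[s + ->]; elim: s x => //= z s IHs x /andP[rxz sP] Qx.
by apply: IHs sP _; exact: rQ Qx.
Qed.

Lemma fin_argmax (R : realDomainType) (T : finType) (x0 : T) (f : T -> R) :
  exists x, forall y, f y <= f x.
Proof. by exists [arg max_(x > x0) f x]%O; case: arg_maxP => // x _ + y; apply. Qed.

Lemma sum_mul_delta (R : pzSemiRingType) (T : finType) (F : T -> R) i :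
  \sum_k F k * (k == i)%:R = F i.
Proof.
by rewrite (bigD1 i)//= eqxx mulr1 big1 ?addr0// => k /negbTE ->; rewrite mulr0.
Qed.

Lemma sum_sqr_ge0 (R : realDomainType) (T : finType) (f : T -> R) :
  0 <= \sum_k f k ^+ 2.
Proof. by apply: sumr_ge0 => k _; exact: sqr_ge0. Qed.

Lemma ler_mul_norm (R : realDomainType) (x y a b : R) :
  `|x| <= a -> `|y| <= b -> x * y <= a * b.
Proof. by move=> xa yb; apply: (le_trans (ler_norm _)); rewrite normrM ler_pM. Qed.

Section Mean.
Context {R : realFieldType} {I : finType}.
Variable P : I -> R.

Definition mean (f : I -> R) : R := \sum_e P e * f e.

Lemma eq_mean f g : f =1 g -> mean f = mean g.
Proof. by move=> fg; apply: eq_bigr => e _; rewrite fg. Qed.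

Lemma meanD f g : mean (fun e => f e + g e) = mean f + mean g.
Proof. by rewrite -big_split; apply: eq_bigr => e _; rewrite mulrDr. Qed.

Lemma meanZ a f : mean (fun e => a * f e) = a * mean f.
Proof. by rewrite mulr_sumr; apply: eq_bigr => e _; rewrite mulrCA. Qed.

Lemma meanB f g : mean (fun e => f e - g e) = mean f - mean g.
Proof. by rewrite -sumrB; apply: eq_bigr => e _; rewrite mulrBr. Qed.

Lemma mean_sum (J : Type) (r : seq J) (F : J -> I -> R) :
  mean (fun e => \sum_(j <- r) F j e) = \sum_(j <- r) mean (F j).
Proof. by rewrite exchange_big; apply: eq_bigr => e _; rewrite mulr_sumr. Qed.

Hypothesis P_ge0 : forall e, 0 <= P e.

Lemma ler_mean f g : (forall e, 0 < P e -> f e <= g e) -> mean f <= mean g.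
Proof.
move=> fg; apply: ler_sum => e _.
have := P_ge0 e; rewrite le_eqVlt => /predU1P[<-|Pe]; first by rewrite !mul0r.
by rewrite ler_pM2l// fg.
Qed.

Hypothesis P_sum1 : \sum_e P e = 1.

Lemma mean_cst a : mean (fun=> a) = a.
Proof. by rewrite /mean -mulr_suml P_sum1 mul1r. Qed.

Lemma exists_weight_gt0 : exists e, 0 < P e.
Proof.
apply: contrapT => none; have /eqP := P_sum1; rewrite big1 => [|e _].
  by rewrite eq_sym oner_eq0.
by apply/eqP; rewrite eq_le P_ge0 andbT leNgt; apply/negP => Pe; apply: none; exists e.
Qed.

Lemma norm_sub_mean_le a f r : (forall e, `|a - f e| <= r) -> `|a - mean f| <= r.
Proof.
move=> fr; rewrite -{1}[a]mean_cst -meanB.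
apply: (le_trans (ler_norm_sum _ _ _)); rewrite -[leRHS]mean_cst.
by apply: ler_sum => e _; rewrite normrM ger0_norm// ler_wpM2l.
Qed.

End Mean.

Lemma norm_sub_average_le (R : realFieldType) (n : nat) (f : 'I_n -> R) (a r : R) :
  (0 < n)%N -> (forall k, `|a - f k| <= r) -> `|a - (\sum_k f k) / n%:R| <= r.
Proof.
move=> n_gt0 fr; rewrite mulrC mulr_sumr; apply: norm_sub_mean_le => // [k|].
  by rewrite invr_ge0.
by rewrite sumr_const card_ord -[LHS]mulr_natl divff// pnatr_eq0 -lt0n.
Qed.

Lemma mean_pair (R : realFieldType) (I J : finType) (P f : I * J -> R) :
  mean P f = \sum_i \sum_j P (i, j) * f (i, j).
Proof. by rewrite pair_bigA; apply: eq_bigr => -[]. Qed.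

(** * Generators of irreducible Markov chains *)

Section Generator.
Context {R : realFieldType} {T : finType}.
Variable C : T -> T -> R.
Implicit Types (f g : T -> R) (i j k : T).

Definition generator f i : R := \sum_j C i j * (f j - f i).

Lemma eq_generator f g : f =1 g -> generator f =1 generator g.
Proof. by move=> fg i; apply: eq_bigr => j _; rewrite !fg. Qed.

Lemma generatorD f g i :
  generator (fun j => f j + g j) i = generator f i + generator g i.
Proof. by rewrite -big_split; apply: eq_bigr => j _ /=; ring. Qed.

Lemma generatorZ a f i : generator (fun j => a * f j) i = a * generator f i.
Proof. by rewrite mulr_sumr; apply: eq_bigr => j _; ring. Qed.

Lemma generator_sum (J : Type) (r : seq J) (F : J -> T -> R) i :
  generator (fun k => \sum_(j <- r) F j k) i = \sum_(j <- r) generator (F j) i.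
Proof.
by rewrite exchange_big; apply: eq_bigr => j _; rewrite -sumrB mulr_sumr.
Qed.

Lemma generator_cst f i : (forall j, f j = f i) -> generator f i = 0.
Proof. by move=> fi; rewrite /generator big1// => j _; rewrite fi subrr mulr0. Qed.

Definition dirichlet f : R := \sum_i \sum_j C i j * (f i - f j) ^+ 2.

Hypothesis C_ge0 : forall i j, 0 <= C i j.

Lemma subharmonic_max_propagates f i k :
  (forall j, 0 <= generator f j) -> (forall j, f j <= f i) ->
  connect (fun a b => 0 < C a b) i k -> f k = f i.
Proof.
move=> subf fi ik; apply: (connect_ind (Q := fun k => f k = f i)) ik _ => // u v Cuv fu.
have terms_ge0 j : true -> 0 <= C u j * (f u - f j).
  by move=> _; rewrite mulr_ge0// subr_ge0 fu.
have : \sum_j C u j * (f u - f j) == 0.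
  rewrite eq_le sumr_ge0// andbT -oppr_ge0 -sumrN; apply: le_trans (subf u) _.
  by apply: ler_sum => j _; rewrite -mulrN opprB.
rewrite psumr_eq0// => /allP/(_ v (mem_index_enum _)) /=.
by rewrite mulf_eq0 gt_eqF// subr_eq0 fu => /eqP.
Qed.

Lemma dirichlet_ge0 f : 0 <= dirichlet f.
Proof.
by apply: sumr_ge0 => i _; apply: sumr_ge0 => j _; rewrite mulr_ge0 ?sqr_ge0.
Qed.

Lemma ler_dirichlet_edge f i j : C i j * (f i - f j) ^+ 2 <= dirichlet f.
Proof.
have term_ge0 a b : 0 <= C a b * (f a - f b) ^+ 2 by rewrite mulr_ge0 ?sqr_ge0.
rewrite /dirichlet (bigD1 i)//= (bigD1 j)//= -addrA lerDl addr_ge0//.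
  exact: sumr_ge0.
by apply: sumr_ge0 => a _; exact: sumr_ge0.
Qed.

Hypothesis C_irreducible : forall i j, connect (fun a b => 0 < C a b) i j.

Lemma subharmonic_constant f : (forall j, 0 <= generator f j) ->
  forall i j, f i = f j.
Proof.
move=> subf i j; have [m fm] := fin_argmax i f.
by rewrite !(subharmonic_max_propagates subf fm (C_irreducible m _)).
Qed.

Lemma constant_generator_eq0 f a i : (forall j, generator f j = a) -> a = 0.
Proof.
wlog a_ge0 : f a / 0 <= a => [wlog|fa].
  have [/wlog|a_lt0 fa] := leP 0 a; first exact.
  apply/eqP; rewrite -oppr_eq0; apply/eqP.
  apply: (wlog (fun j => -1 * f j)) => [|j]; first by rewrite oppr_ge0 ltW.
  by rewrite generatorZ fa mulN1r.
rewrite -(fa i) generator_cst// => j.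
by apply: subharmonic_constant => k; rewrite fa.
Qed.

Lemma poisson_solvable (o : T) (a : T -> R) :
  exists h b, forall i, a i = b + generator h i.
Proof.
(* Adding the value at [o] to the generator makes it injective; the constant [b]
   is then the value at [o] of the solution. *)
pose F (f : {ffun T -> R^o}) : {ffun T -> R^o} := [ffun i => f o + generator f i].
have F_linear : linear F.
  move=> c f g; apply/ffunP => i; rewrite !ffunE /=.
  rewrite (eq_generator (g := fun j => c * f j + g j)) => [|j]; last by rewrite !ffunE.
  rewrite generatorD generatorZ -[c *: f o]/(c * f o) -[c *: _]/(c * _); ring.
pose F_isLinear := GRing.isLinear.Build R _ _ _ F F_linear.
pose Fl : {linear _ -> _} := HB.pack F F_isLinear.
have [f Ff0|h /ffunP hE] := @injective_endomorphism_surjective _ _ Fl _ [ffun i => a i].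
  have fo_Lf i : f o + generator f i = 0 by move/ffunP/(_ i): Ff0; rewrite !ffunE.
  have fo0 : f o = 0.
    apply/eqP; rewrite -oppr_eq0; apply/eqP/(constant_generator_eq0 (f := f) o) => i.
    by apply/eqP; rewrite -addr_eq0 addrC fo_Lf.
  have Lf_ge0 i : 0 <= generator f i by rewrite -(fo_Lf i) fo0 add0r.
  by apply/ffunP => i; rewrite ffunE (subharmonic_constant Lf_ge0 i o).
by exists h, (h o) => i; have := hE i; rewrite !ffunE.
Qed.

Lemma poisson_constant_gt0 (a h : T -> R) b o :
  (forall i, a i = b + generator h i) -> (forall i, 0 <= a i) -> 0 < a o -> 0 < b.
Proof.
move=> aE a_ge0; rewrite aE; apply: contraTT; rewrite -!leNgt => b_le0.
rewrite generator_cst ?addr0// => j; apply: subharmonic_constant => i.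
by have := a_ge0 i; rewrite aE; lra.
Qed.

Lemma stationary_distribution (o : T) : exists2 v : T -> R, forall i, 0 < v i &
  \sum_i v i = 1 /\ forall f, \sum_i v i * generator f i = 0.
Proof.
have /fin_all_exists[h /fin_all_exists[v hvE]] j :
    exists h b, forall i, (i == j)%:R = b + generator h i :> R.
  exact: poisson_solvable.
have decomposition f i :
    f i = \sum_j f j * v j + generator (fun k => \sum_j f j * h j k) i.
  rewrite generator_sum -big_split -[LHS](sum_mul_delta f); apply: eq_bigr => j _ /=.
  by rewrite generatorZ -mulrDr -hvE eq_sym.
exists v => [j|].
  by apply: (poisson_constant_gt0 (o := j) (hvE j)); rewrite ?eqxx.
split=> [|f].
  apply/esym/eqP; rewrite -subr_eq0; apply/eqP.
  apply: (constant_generator_eq0 o (f := fun k => \sum_j 1 * h j k)) => i.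
  have := decomposition (fun=> 1) i; under eq_bigr do rewrite mul1r.
  by move=> /= unitE; rewrite [X in X - _]unitE addrAC subrr add0r.
apply: (constant_generator_eq0 o
  (f := fun k => f k + (-1) * \sum_j generator f j * h j k)) => i.
rewrite generatorD generatorZ {1}(decomposition (generator f)) mulN1r addrK.
by apply: eq_bigr => j _; rewrite mulrC.
Qed.

Lemma dirichlet_pair i k : exists2 A, 0 <= A &
  forall f, (f i - f k) ^+ 2 <= A * dirichlet f.
Proof.
apply: (connect_ind (Q := fun k => exists2 A, 0 <= A &
  forall f, (f i - f k) ^+ 2 <= A * dirichlet f)) (C_irreducible i k) _; last first.
  by exists 0 => // f; rewrite subrr expr0n mul0r.
move=> a b Cab [A A_ge0 AP].
exists (2 * A + 2 * (C a b)^-1) => [|f].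
  by rewrite addr_ge0// mulr_ge0// invr_ge0.
have fab : (f a - f b) ^+ 2 <= (C a b)^-1 * dirichlet f.
  by rewrite ler_pdivlMl// ler_dirichlet_edge.
have := AP f; have := sqr_ge0 ((f i - f a) - (f a - f b)); lra.
Qed.

Lemma poincare : exists2 c, 0 < c &
  forall f i j, c * (f i - f j) ^+ 2 <= dirichlet f.
Proof.
have [A A_ge0 AP] := fin_all_exists2 (fun ij : T * T => dirichlet_pair ij.1 ij.2).
have sumA_ge0 : 0 <= \sum_ij A ij by exact: sumr_ge0.
exists (1 + \sum_ij A ij)^-1 => [|f i j]; first by rewrite invr_gt0; lra.
rewrite ler_pdivrMl; last by lra.
apply: (le_trans (AP (i, j) f)); rewrite ler_wpM2r ?dirichlet_ge0//.
by rewrite (bigD1 (i, j))//= addrCA lerDl addr_ge0// sumr_ge0.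
Qed.

End Generator.

(** * Iterated random maps *)

Section MarkovOperator.
Context {R : realFieldType} {I : finType} {S : Type}.
Variables (P : I -> R) (step : I -> S -> S).
Implicit Types (f g : S -> R) (x y : S).

Definition markov_op f x : R := mean P (fun e => f (step e x)).

Lemma iter_markov_op_linear k a f g x :
  iter k markov_op (fun y => a * f y + g y) x =
  a * iter k markov_op f x + iter k markov_op g x.
Proof.
elim: k x => [//|k IHk] x; rewrite !iterS /markov_op -meanZ -meanD.
by apply: eq_mean => e; exact: IHk.
Qed.

Hypothesis P_ge0 : forall e, 0 <= P e.

Lemma ler_iter_markov_op_on (Inv : S -> Prop) f g k x :
  (forall e y, 0 < P e -> Inv y -> Inv (step e y)) ->
  (forall y, Inv y -> f y <= g y) -> Inv x ->
  iter k markov_op f x <= iter k markov_op g x.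
Proof.
move=> Inv_step fg; elim: k x => [|k IHk] x Inv_x; first exact: fg.
by rewrite !iterS; apply: ler_mean => // e Pe; apply/IHk/Inv_step.
Qed.

Lemma ler_iter_markov_op f g k x : (forall y, f y <= g y) ->
  iter k markov_op f x <= iter k markov_op g x.
Proof. by move=> fg; apply: (ler_iter_markov_op_on (Inv := fun=> True)). Qed.

Hypothesis P_sum1 : \sum_e P e = 1.

Lemma iter_markov_op_cst k a x : iter k markov_op (fun=> a) x = a.
Proof.
elim: k x => [//|k IHk] x; rewrite iterS /markov_op.
by rewrite (eq_mean _ (g := fun=> a)) ?mean_cst.
Qed.

Lemma iter_markov_op_ge0 k f x : (forall y, 0 <= f y) -> 0 <= iter k markov_op f x.
Proof.
by move=> f_ge0; rewrite -(iter_markov_op_cst k 0 x); exact: ler_iter_markov_op.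
Qed.

End MarkovOperator.

Definition transition {R : realFieldType} {I T : finType} (P : I -> R)
  (step : I -> T -> T) x y : R := \sum_(e | step e x == y) P e.

Lemma transition_ge0 (R : realFieldType) (I T : finType) (P : I -> R)
    (step : I -> T -> T) :
  (forall e, 0 <= P e) -> forall x y, 0 <= transition P step x y.
Proof. by move=> P_ge0 x y; exact: sumr_ge0. Qed.

Lemma transition_gt0 (R : realFieldType) (I T : finType) (P : I -> R)
    (step : I -> T -> T) e x :
  (forall e, 0 <= P e) -> 0 < P e -> 0 < transition P step x (step e x).
Proof.
by move=> P_ge0 Pe; rewrite /transition (bigD1 e)//= ltr_pwDl// sumr_ge0.
Qed.

Lemma generator_transition (R : realFieldType) (I T : finType) (P : I -> R)
    (step : I -> T -> T) f x : \sum_e P e = 1 ->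
  generator (transition P step) f x = markov_op P step f x - f x.
Proof.
move=> P_sum1; rewrite -[in RHS](mean_cst P_sum1 (f x)) -meanB /mean.
rewrite (partition_big (fun e => step e x) predT)//=; apply: eq_bigr => y _.
by rewrite mulr_suml; apply: eq_bigr => e /eqP ->.
Qed.

(* The expected values of [N] are summable in time. *)
Lemma foster_lyapunov_cvg0 (R : realType) (I : finType) (S : Type) (P : I -> R)
    (step : I -> S -> S) (Inv : S -> Prop) (V N : S -> R) (c : R) (x : S) :
  (forall e, 0 <= P e) -> \sum_e P e = 1 ->
  (forall e y, 0 < P e -> Inv y -> Inv (step e y)) -> Inv x ->
  0 < c -> (forall y, 0 <= V y) -> (forall y, 0 <= N y) ->
  (forall y, Inv y -> markov_op P step V y <= V y - c * N y) ->
  ((fun k => iter k (markov_op P step) N x) @ \oo --> (0 : R))%classic.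
Proof.
move=> P_ge0 P_sum1 Inv_step Inv_x c_gt0 V_ge0 N_ge0 V_drift.
set M := markov_op P step; set u := fun k => _.
have u_ge0 k : 0 <= u k by exact: iter_markov_op_ge0.
have telescope k : c * \sum_(i < k) u i <= V x - iter k M V x.
  elim: k => [|k IHk]; first by rewrite big_ord0 mulr0 subrr.
  have : iter k.+1 M V x <= - c * u k + iter k M V x.
    rewrite iterSr -iter_markov_op_linear; apply: ler_iter_markov_op_on Inv_x => //.
    by move=> y /V_drift; rewrite addrC mulNr.
  by rewrite big_ord_recr mulrDr /=; lra.
apply: cvg_series_cvg_0; apply: nondecreasing_is_cvgn.
  by apply: nondecreasing_series => k _ _; exact: u_ge0.
exists (V x / c) => _ [k _ <-]; rewrite /series /= big_mkord ler_pdivlMr// mulrC.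
by apply: (le_trans (telescope k)); rewrite gerBl iter_markov_op_ge0.
Qed.

(** * Quadratic forms under coalescing transport *)

Definition pair_map {T : Type} (m : T -> T) (kl : T * T) : T * T := (m kl.1, m kl.2).

Section QuadraticForms.
Context {R : realFieldType} {T : finType}.
Implicit Types (K : T * T -> R) (s u : T -> R) (m : T -> T).

Definition qform K s : R := \sum_k \sum_l K (k, l) * (s k * s l).

Lemma eq_qform K K' s : K =1 K' -> qform K s = qform K' s.
Proof. by move=> KK'; do 2!(apply: eq_bigr => ? _); rewrite KK'. Qed.

Lemma qform_sum (J : Type) (r : seq J) (K : J -> T * T -> R) s :
  qform (fun kl => \sum_(j <- r) K j kl) s = \sum_(j <- r) qform (K j) s.
Proof.
rewrite /qform [RHS]exchange_big; apply: eq_bigr => k _ /=.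
by rewrite [RHS]exchange_big; apply: eq_bigr => l _; rewrite mulr_suml.
Qed.

Lemma qform_diag s : qform (fun kl => (kl.1 == kl.2)%:R) s = \sum_k s k ^+ 2.
Proof.
apply: eq_bigr => k _; rewrite -[RHS](sum_mul_delta (fun l => s k * s l)).
by apply: eq_bigr => l _; rewrite mulrC eq_sym.
Qed.

Lemma qform_cst1 s : qform (fun=> 1) s = (\sum_k s k) ^+ 2.
Proof. by rewrite expr2 big_distrlr; do 2!(apply: eq_bigr => ? _); rewrite mul1r. Qed.

Lemma ler_qform_dist K K' s c : (forall kl, `|K kl - K' kl| <= c) ->
  qform K s <= qform K' s + c * #|T|%:R * \sum_k s k ^+ 2.
Proof.
move=> KK'.
have -> : c * #|T|%:R * \sum_k s k ^+ 2 =
    \sum_k \sum_l c * ((s k ^+ 2 + s l ^+ 2) / 2).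
  transitivity (\sum_k (c / 2) * (#|T|%:R * s k ^+ 2 + \sum_l s l ^+ 2)).
    by rewrite -mulr_sumr big_split /= -mulr_sumr sumr_const -mulr_natl; field.
  apply: eq_bigr => k _; rewrite -mulr_sumr -mulr_suml big_split sumr_const /=.
  by rewrite -mulr_natl; ring.
rewrite /qform -big_split; apply: ler_sum => k _.
rewrite -big_split; apply: ler_sum => l _ /=; rewrite -lerBlDl -mulrBl.
apply: ler_mul_norm (KK' _) _; rewrite ler_norml.
by have := sqr_ge0 (s k - s l); have := sqr_ge0 (s k + s l); lra.
Qed.

Lemma qform_perturb K u d (r b : R) :
  (forall k, `|u k| <= r) -> (forall k, `|d k| <= b) ->
  qform K (fun k => u k + d k) <=
  qform K u + (\sum_k \sum_l `|K (k, l)|) * (2 * r * b + b ^+ 2).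
Proof.
move=> ur db; rewrite mulr_suml -big_split; apply: ler_sum => k _.
rewrite mulr_suml -big_split; apply: ler_sum => l _ /=.
rewrite -lerBlDl -mulrBr; apply: ler_mul_norm => //.
have -> : (u k + d k) * (u l + d l) - u k * u l =
  u k * d l + u l * d k + d k * d l by ring.
have -> : 2 * r * b + b ^+ 2 = r * b + r * b + b * b by ring.
apply: (le_trans (ler_normD _ _)); rewrite lerD ?normrM ?ler_pM//.
by apply: (le_trans (ler_normD _ _)); rewrite !normrM lerD ?ler_pM.
Qed.

Definition pushforward m s l : R := \sum_(k | m k == l) s k.

Lemma sum_pushforward (h : T -> R) m s :
  \sum_l h l * pushforward m s l = \sum_k h (m k) * s k.
Proof.
rewrite [RHS](partition_big m predT)//=; apply: eq_bigr => l _.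
by rewrite mulr_sumr; apply: eq_bigr => k /eqP ->.
Qed.

Lemma qform_pushforward K m s :
  qform K (pushforward m s) = qform (fun kl => K (pair_map m kl)) s.
Proof.
transitivity (\sum_k (\sum_l K (k, m l) * s l) * pushforward m s k).
  apply: eq_bigr => k _; rewrite -(sum_pushforward (fun l => K (k, l)) m s) mulr_suml.
  by apply: eq_bigr => l _ /=; ring.
rewrite (sum_pushforward (fun k => \sum_l K (k, m l) * s l)).
by apply: eq_bigr => k _; rewrite mulr_suml; apply: eq_bigr => l _ /=; ring.
Qed.

Lemma norm_pushforward_le m s t : (forall k, `|s k| <= t) ->
  forall l, `|pushforward m s l| <= #|T|%:R * t.
Proof.
move=> st l; apply: (le_trans (ler_norm_sum _ _ _)).
apply: (@le_trans _ _ (\sum_k `|s k|)).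
  by rewrite [leRHS](bigID (fun k => m k == l))/= lerDl sumr_ge0.
by rewrite mulr_natl -sumr_const; exact: ler_sum.
Qed.

End QuadraticForms.

Section Coalescence.
Context {R : realType} {I T : finType}.
Variables (P : I -> R) (m : I -> T -> T).
Implicit Types (K : T * T -> R) (s : T -> R).

Local Notation pair_op := (markov_op P (fun e => pair_map (m e))).
Local Notation push_op := (markov_op P (fun e => pushforward (m e))).

Lemma push_op_qform K s : push_op (qform K) s = qform (pair_op K) s.
Proof.
rewrite /markov_op (eq_mean _ (fun e => qform_pushforward K (m e) s)) mean_sum.
apply: eq_bigr => k _; rewrite mean_sum; apply: eq_bigr => l _.
by rewrite /markov_op [RHS]mulrC -meanZ; apply: eq_mean => e; rewrite mulrC.
Qed.

Definition meeting_prob t : T * T -> R := iter t pair_op (fun kl => (kl.1 == kl.2)%:R).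
Arguments meeting_prob : simpl never.

Hypothesis P_ge0 : forall e, 0 <= P e.
Hypothesis P_sum1 : \sum_e P e = 1.

Lemma meeting_prob_le1 t kl : meeting_prob t kl <= 1.
Proof.
rewrite -(iter_markov_op_cst (fun e => pair_map (m e)) P_sum1 t 1 kl).
by apply: ler_iter_markov_op => // y; rewrite lern1 leq_b1.
Qed.

Lemma meeting_prob_diag t k : meeting_prob t (k, k) = 1.
Proof.
elim: t k => [|t IHt] k; first by rewrite /meeting_prob /= eqxx.
rewrite /meeting_prob iterS -/(meeting_prob t) -(mean_cst P_sum1 1).
by apply: eq_mean => e; exact: IHt.
Qed.

Lemma meeting_prob_nondecreasing t kl : meeting_prob t kl <= meeting_prob t.+1 kl.
Proof.
rewrite /meeting_prob iterSr; apply: ler_iter_markov_op => // -[k l] /=.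
rewrite -[leLHS](mean_cst P_sum1); apply: ler_mean => // e _ /=.
by case: eqP => [->|_]; rewrite ?eqxx ?ler0n.
Qed.

Hypothesis P_merging : forall kl, exists k,
  connect (fun a b => 0 < transition P (fun e => pair_map (m e)) a b) kl (k, k).

(* The limit is harmonic for the pair walk, so its minimum propagates to the
   diagonal, where it equals 1. *)
Lemma meeting_prob_cvg1 kl : (meeting_prob ^~ kl @ \oo --> (1 : R))%classic.
Proof.
pose g kl := limn (meeting_prob ^~ kl).
have cvg_g ab : (meeting_prob ^~ ab @ \oo --> g ab)%classic.
  apply: nondecreasing_is_cvgn; last first.
    by exists 1 => _ [t _ <-]; exact: meeting_prob_le1.
  by apply/nondecreasing_seqP => t; exact: meeting_prob_nondecreasing.
have g_le1 ab : g ab <= 1.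
  by apply: (cvgr_to_le (cvg_g ab)); apply: nearW => t; exact: meeting_prob_le1.
have g_diag k : g (k, k) = 1.
  apply: (cvg_unique (@Rhausdorff R) (cvg_g (k, k))).
  rewrite (_ : meeting_prob ^~ _ = cst 1); first exact: cvg_cst.
  by apply/funext => t; exact: meeting_prob_diag.
have g_harmonic ab : pair_op g ab = g ab.
  have := cvg_g ab; rewrite -cvg_shiftS; apply: cvg_unique; first exact: Rhausdorff.
  apply: (cvg_big add_continuous) => e _.
  by apply: cvgM; [exact: cvg_cst|exact: cvg_g].
have [ab g_min] := fin_argmax kl (fun ab => - g ab).
have [k abk] := P_merging ab.
have : - g (k, k) = - g ab.
  apply: (subharmonic_max_propagates _ _ g_min abk) => [|j].
    exact: transition_ge0.
  rewrite generator_transition// subr_ge0 -(g_harmonic j) /markov_op /mean -sumrN.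
  by apply: ler_sum => e _; rewrite mulrN.
rewrite g_diag => /oppr_inj g_ab.
suff <- : g kl = 1 by exact: cvg_g.
by apply/eqP; rewrite eq_le g_le1 g_ab -lerN2 g_min.
Qed.

Lemma meeting_prob_near1 (c : R) : 0 < c ->
  exists t, forall kl, `|meeting_prob t.+1 kl - 1| <= c.
Proof.
move=> c_gt0.
have : (\forall t \near \oo, forall kl, `|meeting_prob t kl - 1| <= c)%classic.
  apply: filter_forall => kl; have /cvgrPdist_le/(_ c c_gt0) := meeting_prob_cvg1 kl.
  by apply: filterS => t; rewrite distrC.
by case=> t _ t_near; exists t => kl; apply: t_near => /=.
Qed.

(* [qform (meeting_prob t) s] is the mean squared norm of the masses [s] after
   [t] steps of coalescing transport; the form below adds up these means until
   they are close to their limit [(\sum_k s k) ^+ 2]. *)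
Lemma coalescing_form : exists U : T * T -> R,
  (forall s, \sum_k s k ^+ 2 <= qform U s) /\
  (forall s, push_op (qform U) s <=
             qform U s - (\sum_k s k ^+ 2) / 2 + (\sum_k s k) ^+ 2).
Proof.
have form0 s : qform (meeting_prob 0) s = \sum_k s k ^+ 2 by rewrite -qform_diag.
have form_ge0 t s : 0 <= qform (meeting_prob t) s.
  elim: t s => [|t IHt] s; first by rewrite form0 sum_sqr_ge0.
  rewrite /meeting_prob iterS -/(meeting_prob t) -push_op_qform.
  by rewrite -(mean_cst P_sum1 0); apply: ler_mean => // e _; exact: IHt.
pose c : R := (2 * #|T|%:R + 1)^-1.
have denom_gt0 : 0 < 2 * #|T|%:R + 1 :> R by rewrite ltr_wpDl// mulr_ge0.
have cT_le : c * #|T|%:R <= 2^-1 by rewrite mulrC ler_pdivrMr//; lra.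
have [|t t_near] := @meeting_prob_near1 c; first by rewrite invr_gt0.
exists (fun kl => \sum_(0 <= i < t.+1) meeting_prob i kl); split=> s.
  by rewrite qform_sum big_nat_recl// form0 lerDl sumr_ge0.
have shift : pair_op (fun kl => \sum_(0 <= i < t.+1) meeting_prob i kl) =1
             fun kl => \sum_(0 <= i < t.+1) meeting_prob i.+1 kl.
  by move=> kl; rewrite /markov_op mean_sum.
rewrite push_op_qform (eq_qform s shift) !qform_sum big_nat_recr//=.
rewrite [in leRHS]big_nat_recl// form0.
have := ler_qform_dist s t_near; have := ler_wpM2r (sum_sqr_ge0 s) cT_le.
by rewrite qform_cst1; lra.
Qed.

End Coalescence.

Section ShiftedSquares.
Context {R : realFieldType}.

Lemma norm_contraction_le (c x a : R) : `|c| <= 1 -> `|x| <= a -> `|c * x| <= a.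
Proof. by move=> c1 xa; rewrite normrM -[leRHS]mul1r ler_pM. Qed.

Lemma mean_sqr_shift (T : finType) (v y : T -> R) i (d c : R) : \sum_l v l = 1 ->
  mean v (fun l => (y l + d * (l == i)%:R - c) ^+ 2) =
  mean v (fun l => y l ^+ 2) + v i * (2 * y i * d + d ^+ 2)
  - 2 * c * (mean v y + v i * d) + c ^+ 2.
Proof.
move=> v_sum1.
have -> : mean v (fun l => (y l + d * (l == i)%:R - c) ^+ 2) =
    mean v (fun l => y l ^+ 2 + (2 * d * (y l * (l == i)%:R) + d ^+ 2 * (l == i)%:R
      - 2 * c * (y l + d * (l == i)%:R) + c ^+ 2)).
  by apply: eq_mean => l; case: (l == i) => /=; ring.
have mean_delta (f : T -> R) : mean v (fun l => f l * (l == i)%:R) = v i * f i.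
  rewrite -[RHS](sum_mul_delta (fun l => v l * f l)).
  by apply: eq_bigr => l _; rewrite mulrA.
rewrite meanD meanD meanB meanD !meanZ meanD meanZ mean_cst// mean_delta.
have := mean_delta (fun=> 1); under eq_mean do rewrite mul1r.
by move=> ->; ring.
Qed.

Definition remainder_coef (B : R) : R := 5 + 2 * B + 4 * B ^+ 2.

Lemma shift_remainder_le (v w eps rho tau B u z s Y h d g : R) :
  `|v| <= 1 -> `|w| <= 1 -> `|u| <= rho -> `|z| <= rho -> `|s| <= tau ->
  `|eps * s| <= rho -> `|Y| <= B * tau -> `|h| <= B -> `|d| <= rho ->
  `|g| <= B * tau -> `|eps * g| <= 2 * B * rho ->
  2 * (v * w * u * s) + 2 * (v * w ^+ 2 * z * s) + v * w ^+ 2 * (eps * s) * s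
  + 2 * (Y * (h * d)) - 2 * (v * d * g) + eps * g * g
  <= remainder_coef B * (rho * tau).
Proof.
move=> v1 w1 urho zrho stau epss YB hB drho gB epsg.
have vw1 : `|v * w| <= 1 by exact: norm_contraction_le.
have vww1 : `|v * w ^+ 2| <= 1 by rewrite expr2 mulrA mulrC norm_contraction_le.
have := ler_mul_norm (norm_contraction_le vw1 urho) stau.
have := ler_mul_norm (norm_contraction_le vww1 zrho) stau.
have := ler_mul_norm (norm_contraction_le vww1 epss) stau.
have : Y * (h * d) <= (B * tau) * (B * rho).
  by apply: ler_mul_norm => //; rewrite normrM ler_pM.
have : - (v * d) * g <= rho * (B * tau).
  by apply: ler_mul_norm => //; rewrite normrN norm_contraction_le.
have := ler_mul_norm epsg gB; rewrite /remainder_coef; lra.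
Qed.

End ShiftedSquares.

(** * One step of the gossip algorithm *)

Section GossipStep.
Context {R : realType} {n : nat}.
Variable w : 'I_n -> 'I_n -> R.
Implicit Types (e : 'I_n * 'I_n) (st : state R n) (eps : R) (h s : 'I_n -> R).

Definition increment eps e st : R :=
  w e.2 e.1 * (st.1 e.1 - st.1 e.2) + eps * w e.2 e.1 * st.2 e.2.

Definition transport e k : 'I_n := if k == e.1 then e.2 else k.

Lemma sum_transport h s e :
  \sum_k h (transport e k) * s k = \sum_k h k * s k + (h e.2 - h e.1) * s e.1.
Proof.
rewrite (bigD1 e.1)//= [in RHS](bigD1 e.1)//= /transport eqxx.
rewrite (eq_bigr (fun k => h k * s k)) => [|k /negbTE -> //]; ring.
Qed.

Lemma pushforward_transport e s l : pushforward (transport e) s l =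
  s l + ((l == e.2)%:R - (l == e.1)%:R) * s e.1.
Proof.
have := sum_transport (fun k => (l == k)%:R) s e.
rewrite -(sum_pushforward (fun k => (l == k)%:R)).
by do 2!(under eq_bigr do rewrite mulrC eq_sym; rewrite sum_mul_delta).
Qed.

Lemma gossip_step_fst eps e st l :
  (gossip_step w eps e st).1 l = st.1 l + increment eps e st * (l == e.2)%:R.
Proof. by rewrite /increment /=; case: eqP => [->|_] /=; ring. Qed.

Lemma gossip_step_snd eps e st l : e.1 != e.2 ->
  (gossip_step w eps e st).2 l =
  pushforward (transport e) st.2 l - increment eps e st * (l == e.2)%:R.
Proof.
move=> ne; rewrite pushforward_transport /increment /=.
have [->|_] := eqVneq l e.2; first by rewrite eq_sym (negbTE ne) /=; ring.
by case: eqP => [->|_] /=; ring.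
Qed.

Definition flux h eps e st : R :=
  (h e.2 - h e.1) * st.2 e.1 - h e.2 * increment eps e st.

Lemma potential_gossip_step h eps e st : e.1 != e.2 ->
  \sum_k h k * (gossip_step w eps e st).2 k = \sum_k h k * st.2 k + flux h eps e st.
Proof.
move=> ne; under eq_bigr do rewrite gossip_step_snd// mulrBr mulrA.
rewrite sumrB sum_pushforward sum_transport.
by rewrite (sum_mul_delta (fun k => h k * increment eps e st)) addrA.
Qed.

Lemma sum_gossip_step eps e st : e.1 != e.2 ->
  \sum_l (gossip_step w eps e st).1 l + \sum_l (gossip_step w eps e st).2 l =
  \sum_l st.1 l + \sum_l st.2 l.
Proof.
move=> ne; have sum1 (f : 'I_n -> R) : \sum_k 1 * f k = \sum_k f k.
  by apply: eq_bigr => k _; rewrite mul1r.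
rewrite -[X in _ + X = _]sum1 (potential_gossip_step (fun=> 1))// sum1.
under eq_bigr do rewrite gossip_step_fst.
by rewrite big_split (sum_mul_delta (fun=> increment eps e st)) /flux /=; ring.
Qed.

Definition recenter (a : R) st : state R n := ((fun l => st.1 l - a), st.2).

Lemma gossip_step_recenter a eps e st :
  gossip_step w eps e (recenter a st) = recenter a (gossip_step w eps e st).
Proof.
rewrite /gossip_step /recenter /=; congr (_, _); apply/funext => l.
  by case: eqP => // _; ring.
by case: eqP => // _; ring.
Qed.

Definition corrected h eps st l : R := st.1 l - eps * \sum_k h k * st.2 k.

Lemma corrected_gossip_step h eps e st l : e.1 != e.2 ->
  corrected h eps (gossip_step w eps e st) l =
  corrected h eps st l + increment eps e st * (l == e.2)%:R - eps * flux h eps e st.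
Proof.
by move=> ne; rewrite /corrected gossip_step_fst potential_gossip_step//; ring.
Qed.

End GossipStep.

Definition dissipation {R : realFieldType} {n : nat} (P : 'I_n * 'I_n -> R)
    (w : 'I_n -> 'I_n -> R) (v x : 'I_n -> R) : R :=
  mean P (fun e => v e.2 * (w e.2 e.1 * (1 - w e.2 e.1)) * (x e.2 - x e.1) ^+ 2).

Section Drift.
Context {R : realType} {n : nat}.
Variables (P : 'I_n * 'I_n -> R) (w : 'I_n -> 'I_n -> R).
Hypothesis P_ge0 : forall e, 0 <= P e.
Hypothesis P_sum1 : \sum_e P e = 1.
Hypothesis P_loopless : forall e, 0 < P e -> e.1 != e.2.
Hypothesis w_bounds : forall e, 0 < P e -> 0 < w e.2 e.1 < 1.
Variables (v h : 'I_n -> R) (alpha : R).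
Hypothesis v_gt0 : forall k, 0 < v k.
Hypothesis v_sum1 : \sum_k v k = 1.
Hypothesis v_stationary : forall f : 'I_n -> R,
  mean P (fun e => v e.2 * (w e.2 e.1 * (f e.1 - f e.2))) = 0.
Hypothesis h_poisson : forall k,
  v k * \sum_j P (j, k) * w k j = alpha + generator (fun k j => P (k, j)) h k.
Hypothesis alpha_gt0 : 0 < alpha.
Variable U : 'I_n * 'I_n -> R.
Hypothesis U_ge : forall s, \sum_k s k ^+ 2 <= qform U s.
Hypothesis U_drift : forall s,
  markov_op P (fun e => pushforward (transport e)) (qform U) s <=
  qform U s - (\sum_k s k ^+ 2) / 2 + (\sum_k s k) ^+ 2.
Hypothesis n_gt0 : (0 < n)%N.

Local Notation hnorm := (\sum_k `|h k|).
Local Notation hbound := (2 * (1 + hnorm)).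

Let hnorm_ge0 : 0 <= hnorm. Proof. exact: sumr_ge0. Qed.
Let h_le k : `|h k| <= hnorm. Proof. by rewrite (bigD1 k)//= lerDl sumr_ge0. Qed.

Definition gossip_energy eps (st : state R n) : R :=
  mean v (fun l => corrected h eps st l ^+ 2) + eps * (2 * alpha / n%:R * qform U st.2).

Lemma gossip_energy_ge0 eps st : 0 <= eps -> 0 <= gossip_energy eps st.
Proof.
move=> eps_ge0; rewrite addr_ge0//.
  by apply: sumr_ge0 => k _; rewrite mulr_ge0 ?sqr_ge0// ltW.
rewrite !mulr_ge0 ?invr_ge0 ?(ltW alpha_gt0)//.
exact: le_trans (sum_sqr_ge0 _) (U_ge _).
Qed.

Definition energy_error : R :=
  remainder_coef hbound + 2 * alpha * n%:R * hbound
  + 2 * alpha / n%:R * ((\sum_k \sum_l `|U (k, l)|) * (2 * n%:R)).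

Lemma energy_error_ge0 : 0 <= energy_error.
Proof.
have U_norm_ge0 : 0 <= \sum_k \sum_l `|U (k, l)|.
  by apply: sumr_ge0 => k _; exact: sumr_ge0.
have hbound_ge0 : 0 <= hbound by have := hnorm_ge0; lra.
have alpha_ge0 := ltW alpha_gt0.
rewrite /energy_error /remainder_coef; move: hbound hbound_ge0 => b b_ge0.
by rewrite !addr_ge0 ?mulr_ge0 ?sqr_ge0 ?invr_ge0.
Qed.

Section OneStep.
Variables (eps r t : R) (st : state R n).
Hypothesis eps_bounds : 0 < eps <= 1.
Hypothesis balanced : \sum_l st.1 l + \sum_l st.2 l = 0.
Hypothesis spread : forall k l, `|st.1 k - st.1 l| <= r.
Hypothesis surplus_le : forall k, `|st.2 k| <= t.

(* [rho] bounds the increment, and all error terms are O([eps * rho * tau]). *)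
Local Notation rho := (r + eps * t).
Local Notation tau := (t + rho).
Local Notation inc e := (increment w eps e st).
Local Notation total := (\sum_k st.2 k).
Local Notation y := (corrected h eps st).

Let eps_gt0 : 0 < eps. Proof. by case/andP: eps_bounds. Qed.
Let eps_ge0 : 0 <= eps := ltW eps_gt0.
Let t_ge0 : 0 <= t. Proof. exact: le_trans (surplus_le (Ordinal n_gt0)). Qed.
Let r_ge0 : 0 <= r.
Proof. exact: le_trans (spread (Ordinal n_gt0) (Ordinal n_gt0)). Qed.
Let rho_ge0 : 0 <= rho. Proof. by rewrite addr_ge0// mulr_ge0. Qed.

Lemma norm_increment_le e : 0 < P e -> `|inc e| <= rho.
Proof.
move=> /w_bounds/andP[w_gt0 w_lt1].
have w_norm : `|w e.2 e.1| <= 1 by rewrite gtr0_norm// ltW.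
apply: (le_trans (ler_normD _ _)); apply: lerD; first exact: norm_contraction_le.
by rewrite -mulrA normrM gtr0_norm// ler_pM2l// norm_contraction_le.
Qed.

Lemma mean_qform_surplus :
  mean P (fun e => qform U (gossip_step w eps e st).2) <=
  markov_op P (fun e => pushforward (transport e)) (qform U) st.2
  + (\sum_k \sum_l `|U (k, l)|) * (2 * n%:R) * (rho * tau).
Proof.
rewrite -[X in _ <= _ + X](mean_cst P_sum1) -meanD; apply: ler_mean => // e Pe.
have d_le l : `|- (inc e * (l == e.2)%:R)| <= rho.
  rewrite normrN mulrC norm_contraction_le ?norm_increment_le//.
  by rewrite ger0_norm// lern1 leq_b1.
rewrite (_ : (gossip_step w eps e st).2 =
  fun l => pushforward (transport e) st.2 l + - (inc e * (l == e.2)%:R)); last first.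
  by apply/funext => l; rewrite gossip_step_snd// P_loopless.
apply: (le_trans (qform_perturb U (norm_pushforward_le _ surplus_le) d_le)).
rewrite lerD2l -[leRHS]mulrA ler_wpM2l ?sumr_ge0// => [k _|]; first exact: sumr_ge0.
rewrite card_ord; have n_ge1 : 1 <= n%:R :> R by rewrite ler1n.
have : 0 <= (2 * n%:R - 1) * rho ^+ 2 by rewrite mulr_ge0 ?sqr_ge0//; lra.
lra.
Qed.

Lemma norm_flux_le e : 0 < P e -> `|flux w h eps e st| <= hbound * tau.
Proof.
move=> Pe; have hh_le : `|h e.2 - h e.1| <= 2 * hnorm.
  by rewrite (le_trans (ler_normB _ _))// mulrDl mul1r lerD.
apply: (@le_trans _ _ (2 * hnorm * t + hnorm * rho)).
  apply: (le_trans (ler_normB _ _)); apply: lerD; rewrite normrM ler_pM//.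
  exact: norm_increment_le.
have := mulr_ge0 hnorm_ge0 rho_ge0; have := t_ge0; have := rho_ge0; lra.
Qed.

Lemma norm_eps_flux_le e : 0 < P e -> `|eps * flux w h eps e st| <= 2 * hbound * rho.
Proof.
move=> Pe; rewrite normrM gtr0_norm//.
apply: (le_trans (ler_wpM2l eps_ge0 (norm_flux_le Pe))).
rewrite mulrCA [2 * hbound]mulrC -[leRHS]mulrA ler_wpM2l//.
  by have := hnorm_ge0; lra.
have /andP[_ eps_le1] := eps_bounds.
by have := ler_piMl rho_ge0 eps_le1; have := r_ge0; lra.
Qed.

Lemma sum_value_opp : \sum_k st.1 k = - total.
Proof. by apply/eqP; rewrite -addr_eq0 balanced. Qed.

Lemma norm_average_surplus_le : `|total / n%:R| <= t.
Proof.
rewrite -[X in `|X|]opprK normrN -[- _]add0r.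
by apply: norm_sub_average_le => // k; rewrite sub0r normrN.
Qed.

Lemma value_near_average k : `|st.1 k + total / n%:R| <= r.
Proof. by rewrite -[total]opprK -sum_value_opp mulNr norm_sub_average_le. Qed.

Lemma sqnorm_value_le : sqnorm st.1 <= n%:R * (r + t) ^+ 2.
Proof.
rewrite mulr_natl -[in leRHS](card_ord n) -sumr_const; apply: ler_sum => k _.
rewrite -real_normK ?num_real// lerXn2r ?nnegrE ?addr_ge0//.
rewrite -[st.1 k](addrK (total / n%:R)) (le_trans (ler_normB _ _))//.
by rewrite lerD ?value_near_average ?norm_average_surplus_le.
Qed.

Lemma mean_corrected_near : `|total / n%:R + mean v y| <= hbound * rho.
Proof.
rewrite /corrected meanB mean_cst// addrA.
have x_near : `|total / n%:R + mean v st.1| <= r.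
  rewrite -normrN opprD; apply: norm_sub_mean_le => // k; first exact: ltW.
  by rewrite -opprD normrN addrC value_near_average.
have hs_le : `|\sum_k h k * st.2 k| <= hnorm * t.
  apply: (le_trans (ler_norm_sum _ _ _)); rewrite mulr_suml.
  by apply: ler_sum => k _; rewrite normrM ler_wpM2l.
apply: (le_trans (ler_normB _ _)); rewrite normrM gtr0_norm//.
have := ler_wpM2l eps_ge0 hs_le; have := r_ge0; have := mulr_ge0 hnorm_ge0 r_ge0.
have epst_ge0 := mulr_ge0 eps_ge0 t_ge0.
have := mulr_ge0 hnorm_ge0 epst_ge0; lra.
Qed.

Lemma norm_mean_corrected_le : `|mean v y| <= hbound * tau.
Proof.
have -> : mean v y = (total / n%:R + mean v y) - total / n%:R.
  by rewrite addrAC subrr add0r.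
apply: (le_trans (ler_normB _ _)).
have := mean_corrected_near; have := norm_average_surplus_le.
have := mulr_ge0 hnorm_ge0 t_ge0; have := t_ge0; lra.
Qed.

Lemma corrected_near_mean k : `|y k - mean v y| <= r.
Proof.
apply: norm_sub_mean_le => // l; first exact: ltW.
by rewrite /corrected opprD opprK addrACA addNr addr0.
Qed.

Lemma corrected_sqr_gossip_step e : 0 < P e ->
  mean v (fun l => corrected h eps (gossip_step w eps e st) l ^+ 2) <=
  mean v (fun l => y l ^+ 2) + v e.2 * (w e.2 e.1 * (y e.1 ^+ 2 - y e.2 ^+ 2))
  - v e.2 * (w e.2 e.1 * (1 - w e.2 e.1)) * (st.1 e.2 - st.1 e.1) ^+ 2
  + 2 * eps * mean v y * (v e.2 * w e.2 e.1 * st.2 e.2 - (h e.2 - h e.1) * st.2 e.1)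
  + eps * (remainder_coef hbound * (rho * tau)).
Proof.
move=> Pe; have /andP[w_gt0 w_lt1] := w_bounds Pe.
have rho_le (x : R) : `|x| <= r -> `|x| <= rho.
  by move=> /le_trans-> //; rewrite lerDl mulr_ge0.
have v_norm : `|v e.2| <= 1.
  by rewrite gtr0_norm// -v_sum1 (bigD1 e.2)//= lerDl sumr_ge0// => k _; exact: ltW.
have w_norm : `|w e.2 e.1| <= 1 by rewrite gtr0_norm// ltW.
have s_le : `|st.2 e.2| <= tau by rewrite (le_trans (surplus_le _))// lerDl.
have eps_s_le : `|eps * st.2 e.2| <= rho.
  by rewrite normrM gtr0_norm// ler_wpDl// ler_wpM2l.
have h_le_bound : `|h e.2| <= hbound.
  by rewrite (le_trans (h_le _))//; have := hnorm_ge0; lra.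
have := shift_remainder_le v_norm w_norm (rho_le _ (corrected_near_mean e.2))
  (rho_le _ (spread e.1 e.2)) s_le eps_s_le norm_mean_corrected_le h_le_bound
  (norm_increment_le Pe) (norm_flux_le Pe) (norm_eps_flux_le Pe).
rewrite -(ler_pM2l eps_gt0) => remainder_le.
under eq_mean do rewrite corrected_gossip_step ?P_loopless//.
rewrite mean_sqr_shift//; move: remainder_le.
move: (remainder_coef _ * _) (mean v y) (mean v _) => remainder vy vy2.
rewrite /flux /increment /corrected; lra.
Qed.

Lemma mean_surplus_input :
  mean P (fun e => v e.2 * w e.2 e.1 * st.2 e.2 - (h e.2 - h e.1) * st.2 e.1) =
  alpha * total.
Proof.
have received : mean P (fun e => v e.2 * w e.2 e.1 * st.2 e.2) =
    \sum_k (v k * \sum_j P (j, k) * w k j) * st.2 k.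
  rewrite mean_pair exchange_big; apply: eq_bigr => k _ /=.
  by rewrite mulr_sumr mulr_suml; apply: eq_bigr => j _; ring.
have sent : mean P (fun e => (h e.2 - h e.1) * st.2 e.1) =
    \sum_k generator (fun k j => P (k, j)) h k * st.2 k.
  rewrite mean_pair; apply: eq_bigr => k _ /=.
  by rewrite mulr_suml; apply: eq_bigr => j _; rewrite mulrA.
rewrite meanB received sent -sumrB mulr_sumr; apply: eq_bigr => k _.
by rewrite h_poisson; ring.
Qed.

Lemma mean_corrected_sqr :
  mean P (fun e => mean v (fun l => corrected h eps (gossip_step w eps e st) l ^+ 2)) <=
  mean v (fun l => y l ^+ 2) - dissipation P w v st.1
  + 2 * eps * mean v y * (alpha * total)
  + eps * (remainder_coef hbound * (rho * tau)).
Proof.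
apply: (le_trans (ler_mean P_ge0 corrected_sqr_gossip_step)).
rewrite meanD meanD meanB meanD !mean_cst// meanZ mean_surplus_input.
by rewrite (v_stationary (fun l => y l ^+ 2)) addr0.
Qed.

Lemma corrected_sqr_drift :
  mean P (fun e => mean v (fun l => corrected h eps (gossip_step w eps e st) l ^+ 2)) <=
  mean v (fun l => y l ^+ 2) - dissipation P w v st.1
  - 2 * alpha / n%:R * eps * total ^+ 2
  + eps * ((remainder_coef hbound + 2 * alpha * n%:R * hbound) * (rho * tau)).
Proof.
apply: (le_trans mean_corrected_sqr).
have total_le : `|alpha * total| <= alpha * n%:R * tau.
  rewrite normrM gtr0_norm// -mulrA ler_pM2l// mulrC -ler_pdivrMr ?ltr0n//.
  rewrite -[n%:R in X in X <= _]ger0_norm// -normf_div.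
  by rewrite (le_trans norm_average_surplus_le)// lerDl.
have := ler_mul_norm mean_corrected_near total_le.
rewrite -(ler_pM2l eps_gt0); move: (n%:R^-1) => n_inv; lra.
Qed.

Lemma gossip_energy_drift :
  mean P (fun e => gossip_energy eps (gossip_step w eps e st)) <=
  gossip_energy eps st - dissipation P w v st.1 - eps * (alpha / n%:R * sqnorm st.2)
  + energy_error * (eps * (rho * tau)).
Proof.
have kappa_gt0 : 0 < 2 * alpha / n%:R by rewrite !divr_gt0 ?mulr_gt0 ?ltr0n.
have U_step := le_trans mean_qform_surplus (lerD (U_drift st.2) (lexx _)).
rewrite -(ler_pM2l kappa_gt0) -(ler_pM2l eps_gt0) in U_step.
rewrite /gossip_energy meanD !meanZ /energy_error.
have := corrected_sqr_drift; rewrite /sqnorm.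
move: U_step; lra.
Qed.

End OneStep.

Lemma gossip_energy_decrease (c eps : R) st :
  0 < c -> (forall k l, c * (st.1 k - st.1 l) ^+ 2 <= dissipation P w v st.1) ->
  0 < eps <= 1 -> (forall r t, 0 <= r -> 0 <= t ->
    energy_error * (eps * ((r + eps * t) * (t + (r + eps * t)))) <=
    c / 2 * r ^+ 2 + eps * (alpha / n%:R / 2) * t ^+ 2) ->
  \sum_l st.1 l + \sum_l st.2 l = 0 ->
  mean P (fun e => gossip_energy eps (gossip_step w eps e st)) <=
  gossip_energy eps st - Num.min (c / 2) (eps * (alpha / n%:R / 2)) / (2 * n%:R + 1)
    * (sqnorm st.1 + sqnorm st.2).
Proof.
move=> c_gt0 coercive eps_bounds absorbed balanced.
have [eps_gt0 _] := andP eps_bounds.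
set D := dissipation P w v st.1 in coercive *; set rate := Num.min _ _.
pose r := Num.sqrt (D / c); pose t := Num.sqrt (sqnorm st.2).
have D_ge0 : 0 <= D.
  by have := coercive (Ordinal n_gt0) (Ordinal n_gt0); rewrite subrr expr0n mulr0.
have r2 : c * r ^+ 2 = D.
  by rewrite sqr_sqrtr ?divr_ge0 ?(ltW c_gt0)// mulrC divfK// gt_eqF.
have t2 : t ^+ 2 = sqnorm st.2 by rewrite sqr_sqrtr// sum_sqr_ge0.
have spread k l : `|st.1 k - st.1 l| <= r.
  by rewrite -sqrtr_sqr ler_wsqrtr// ler_pdivlMr// mulrC.
have surplus_le k : `|st.2 k| <= t.
  rewrite -sqrtr_sqr ler_wsqrtr// /sqnorm (bigD1 k)//= lerDl.
  by apply: sumr_ge0 => l _; exact: sqr_ge0.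
have [r_ge0 t_ge0] : 0 <= r /\ 0 <= t by rewrite !sqrtr_ge0.
have denom_gt0 : 0 < 2 * n%:R + 1 :> R by rewrite ltr_wpDl// mulr_ge0.
have state_le : sqnorm st.1 + sqnorm st.2 <= (2 * n%:R + 1) * (r ^+ 2 + t ^+ 2).
  have := sqnorm_value_le balanced spread surplus_le; rewrite -t2.
  have := mulr_ge0 (ler0n R n) (sqr_ge0 (r - t)); have := sqr_ge0 r; lra.
have rate_le : rate / (2 * n%:R + 1) * (sqnorm st.1 + sqnorm st.2) <=
    c / 2 * r ^+ 2 + eps * (alpha / n%:R / 2) * t ^+ 2.
  apply: (@le_trans _ _ (rate * (r ^+ 2 + t ^+ 2))).
    rewrite mulrAC ler_pdivrMr// -mulrA ler_wpM2l 1?mulrC//.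
    by rewrite le_min !mulr_ge0 ?invr_ge0// ltW.
  by rewrite mulrDr lerD// ler_wpM2r ?sqr_ge0// ge_min lexx ?orbT.
have := gossip_energy_drift eps_bounds balanced spread surplus_le.
have := absorbed r t r_ge0 t_ge0; rewrite -/D -r2 -t2 in rate_le *; lra.
Qed.

End Drift.

(** * The Lyapunov function *)

Lemma cross_terms_absorbed (R : realFieldType) (C c k : R) : 0 <= C -> 0 < c -> 0 < k ->
  exists2 eps0, 0 < eps0 <= 1 & forall eps r t, 0 < eps < eps0 -> 0 <= r -> 0 <= t ->
  C * (eps * ((r + eps * t) * (t + (r + eps * t)))) <= c * r ^+ 2 + eps * k * t ^+ 2.
Proof.
move=> C_ge0 c_gt0 k_gt0; pose square_cost := 2 * C / c.
pose cross_cost := (9 * C ^+ 2 / (2 * c) + 2 * C) / k.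
have square_cost_ge0 : 0 <= square_cost by rewrite divr_ge0 ?mulr_ge0// ltW.
have cross_cost_ge0 : 0 <= cross_cost.
  by rewrite divr_ge0 ?addr_ge0 ?mulr_ge0 ?invr_ge0 ?mulr_ge0 ?sqr_ge0// ltW.
have total_cost_gt0 : 0 < 1 + square_cost + cross_cost by lra.
exists (1 + square_cost + cross_cost)^-1 => [|eps r t /andP[eps_gt0 eps_lt] r_ge0 t_ge0].
  by rewrite invr_gt0 total_cost_gt0 invf_le1//; lra.
have budget : eps + square_cost * eps + cross_cost * eps < 1.
  by move: eps_lt; rewrite -[_^-1]mul1r ltr_pdivlMr//; lra.
have eps_ge0 := ltW eps_gt0.
have eps_square_ge0 := mulr_ge0 square_cost_ge0 eps_ge0.
have eps_cross_ge0 := mulr_ge0 cross_cost_ge0 eps_ge0.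
have square_small : 2 * C * eps <= c.
  by rewrite -[leRHS]mul1r -ler_pdivrMr// mulrAC -/square_cost; lra.
have cross_small : (9 * C ^+ 2 / (2 * c) + 2 * C) * eps <= k.
  by rewrite -[leRHS]mul1r -ler_pdivrMr// mulrAC -/cross_cost; lra.
have amgm : 3 * C * eps * (r * t) <=
    c / 2 * r ^+ 2 + 9 * C ^+ 2 / (2 * c) * eps ^+ 2 * t ^+ 2.
  rewrite -subr_ge0 [leRHS](_ : _ = c / 2 * (r - 3 * C * eps * t / c) ^+ 2).
    by rewrite mulr_ge0 ?sqr_ge0// divr_ge0// ltW.
  by field; exact: lt0r_neq0.
have eps_le1 : 0 <= 1 - eps by lra.
have := ler_wpM2r (sqr_ge0 r) square_small.
have := ler_wpM2r (mulr_ge0 eps_ge0 (sqr_ge0 t)) cross_small.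
have := mulr_ge0 (mulr_ge0 C_ge0 eps_ge0) (mulr_ge0 eps_le1 (mulr_ge0 r_ge0 t_ge0)).
have := mulr_ge0 (mulr_ge0 C_ge0 (sqr_ge0 eps)) (mulr_ge0 eps_le1 (sqr_ge0 t)).
lra.
Qed.

Section Lyapunov.
Context {R : realType} {n : nat}.
Variables (P : 'I_n * 'I_n -> R) (w : 'I_n -> 'I_n -> R).
Hypothesis P_ge0 : forall e, 0 <= P e.
Hypothesis P_sum1 : \sum_e P e = 1.
Hypothesis P_loopless : forall e, 0 < P e -> e.1 != e.2.
Hypothesis P_connected : forall a b, connect (fun j i => 0 < P (j, i)) a b.
Hypothesis w_bounds : forall e, 0 < P e -> 0 < w e.2 e.1 < 1.
Implicit Types (g : 'I_n * 'I_n -> R) (v : 'I_n -> R).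

Lemma reversed_rate_ge0 g : (forall e, 0 < P e -> 0 < g e) ->
  forall i j, 0 <= P (j, i) * g (j, i).
Proof.
move=> g_gt0 i j; have := P_ge0 (j, i); rewrite le_eqVlt => /predU1P[<-|Pji].
  by rewrite mul0r.
by rewrite mulr_ge0// ltW// g_gt0.
Qed.

Lemma reversed_rate_irreducible g : (forall e, 0 < P e -> 0 < g e) ->
  forall a b, connect (fun i j => 0 < P (j, i) * g (j, i)) a b.
Proof.
move=> g_gt0 a b; pose r : rel 'I_n := fun j i => 0 < P (j, i) * g (j, i).
rewrite -[connect _ a b]/(connect [rel i j | r j i] a b) connect_rev /=.
apply: connect_sub (P_connected b a) => j i Pji; apply: connect1.
by rewrite /r mulr_gt0// g_gt0.
Qed.

Lemma averaging_stationary_distribution : exists2 v, forall k, 0 < v k &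
  \sum_k v k = 1 /\
  forall f : 'I_n -> R, mean P (fun e => v e.2 * (w e.2 e.1 * (f e.1 - f e.2))) = 0.
Proof.
pose g e := w e.2 e.1.
have g_gt0 e : 0 < P e -> 0 < g e by move=> /w_bounds/andP[].
have [e _] := exists_weight_gt0 P_ge0 P_sum1.
have [v v_gt0 [v_sum1 v_stationary]] := stationary_distribution
  (reversed_rate_ge0 g_gt0) (reversed_rate_irreducible g_gt0) e.1.
exists v => //; split=> // f; rewrite -(v_stationary f) mean_pair exchange_big.
by apply: eq_bigr => i _; rewrite mulr_sumr; apply: eq_bigr => j _ /=; rewrite /g; ring.
Qed.

Lemma surplus_potential v : (forall k, 0 < v k) -> exists h alpha, 0 < alpha /\
  forall k, v k * \sum_j P (j, k) * w k j = alpha + generator (fun k j => P (k, j)) h k.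
Proof.
move=> v_gt0; have [e Pe] := exists_weight_gt0 P_ge0 P_sum1.
have token_rate_ge0 i j : 0 <= P (i, j) by [].
have [h [alpha h_poisson]] := poisson_solvable token_rate_ge0 P_connected e.1
  (fun k => v k * \sum_j P (j, k) * w k j).
have w_gt0 e' : 0 < P e' -> 0 < w e'.2 e'.1 by move=> /w_bounds/andP[].
have rate_ge0 k j : 0 <= P (j, k) * w k j := reversed_rate_ge0 w_gt0 k j.
exists h, alpha; split=> //.
apply: (poisson_constant_gt0 (o := e.2) token_rate_ge0 P_connected h_poisson) => [k|].
  by rewrite mulr_ge0 ?sumr_ge0// ltW.
rewrite mulr_gt0// (bigD1 e.1)//= ltr_pwDl ?sumr_ge0//.
by rewrite mulr_gt0 ?w_gt0// -surjective_pairing.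
Qed.

Lemma dissipation_coercive v : (forall k, 0 < v k) -> exists2 c, 0 < c &
  forall (x : 'I_n -> R) k l, c * (x k - x l) ^+ 2 <= dissipation P w v x.
Proof.
move=> v_gt0; pose g e := v e.2 * (w e.2 e.1 * (1 - w e.2 e.1)).
have g_gt0 e : 0 < P e -> 0 < g e.
  by move=> /w_bounds/andP[w_gt0 w_lt1]; rewrite !mulr_gt0// subr_gt0.
have [c c_gt0 c_le] :=
  poincare (reversed_rate_ge0 g_gt0) (reversed_rate_irreducible g_gt0).
exists c => // x k l; apply: (le_trans (c_le x k l)).
rewrite /dissipation mean_pair exchange_big /dirichlet; apply: ler_sum => i _.
by apply: ler_sum => j _; rewrite [leRHS]mulrA.
Qed.

Lemma transport_merging kl : exists k,
  connect (fun a b => 0 < transition P (fun e => pair_map (transport e)) a b) kl (k, k).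
Proof.
case: kl => k l; exists l; set r := (fun a b => _); apply: contraT => k_apart.
suff : ~~ connect r (l, l) (l, l) by rewrite connect0.
apply: (connect_ind (Q := fun k => ~~ connect r (k, l) (l, l)))
  (P_connected k l) k_apart => a b Pab; apply: contraNN.
have [->|al] := eqVneq a l; first by rewrite connect0.
apply: connect_trans; apply: connect1; rewrite /r.
have -> : (b, l) = pair_map (transport (a, b)) (a, l).
  by rewrite /pair_map /transport /= eqxx eq_sym (negbTE al).
exact: transition_gt0.
Qed.

Lemma gossip_lyapunov : exists2 epsb : R, 0 < epsb & forall eps, 0 < eps < epsb ->
  exists V : state R n -> R, exists2 c, 0 < c &
  (forall st, 0 <= V st) /\
  forall st, \sum_l st.1 l + \sum_l st.2 l = 0 ->
    mean P (fun e => V (gossip_step w eps e st)) <=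
    V st - c * (sqnorm st.1 + sqnorm st.2).
Proof.
have [v v_gt0 [v_sum1 v_stationary]] := averaging_stationary_distribution.
have [h [alpha [alpha_gt0 h_poisson]]] := surplus_potential v_gt0.
have [c c_gt0 c_le] := dissipation_coercive v_gt0.
have [U [U_ge U_drift]] := coalescing_form P_ge0 P_sum1 transport_merging.
have [e0 _] := exists_weight_gt0 P_ge0 P_sum1.
have n_gt0 : (0 < n)%N := leq_ltn_trans (leq0n _) (ltn_ord e0.1).
have kappa_gt0 : 0 < alpha / n%:R / 2 by rewrite !divr_gt0// ltr0n.
have [epsb /andP[epsb_gt0 epsb_le1] absorbed] := cross_terms_absorbed
  (energy_error_ge0 h alpha_gt0 U) (divr_gt0 c_gt0 (ltr0Sn R 1)) kappa_gt0.
exists epsb => // eps eps_lt; have /andP[eps_gt0 /ltW eps_le] := eps_lt.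
have eps_bounds : 0 < eps <= 1 by rewrite eps_gt0 (le_trans eps_le).
exists (gossip_energy v h alpha U eps),
  (Num.min (c / 2) (eps * (alpha / n%:R / 2)) / (2 * n%:R + 1)).
  apply: divr_gt0; first by rewrite lt_min divr_gt0//= mulr_gt0.
  by rewrite ltr_wpDl// mulr_ge0.
split=> [st|st balanced]; first by apply: gossip_energy_ge0 => //; exact: ltW.
apply: gossip_energy_decrease => // r t r_ge0 t_ge0; exact: absorbed.
Qed.

End Lyapunov.

(** * Mean-square consensus *)

Lemma sum_tuple_cons (R : nmodType) (T : finType) k (F : seq T -> R) :
  \sum_(t : k.+1.-tuple T) F t = \sum_e \sum_(t : k.-tuple T) F (e :: t).
Proof.
rewrite pair_bigA (reindex (fun q : T * k.-tuple T => cons_tuple q.1 q.2)) //=.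
exists (fun t : k.+1.-tuple T => (thead t, behead_tuple t)) => [[e t] _|t _] /=.
  by congr (_, _); apply: val_inj.
by apply: val_inj; case/tupleP: t.
Qed.

Lemma gossip_expect_iter (R : realType) (n : nat) (E : rel 'I_n)
    (p w : 'I_n -> 'I_n -> R) (eps : R) x0 k f :
  gossip_expect E p w eps x0 k f =
  iter k (markov_op (edge_prob E p) (gossip_step w eps)) f (x0, fun=> 0).
Proof.
rewrite /gossip_expect; move: (x0, fun=> 0) => st.
elim: k st => [|k IHk] st.
  rewrite (big_pred1 [tuple]) ?big_nil ?mul1r// => t.
  by apply/esym/eqP; exact: tuple0.
rewrite (sum_tuple_cons k
  (fun t => (\prod_(e <- t) edge_prob E p e) * f (gossip_run w eps t st))).
rewrite iterS; apply: eq_bigr => e _; rewrite -IHk mulr_sumr.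
by apply: eq_bigr => t _; rewrite big_cons -mulrA.
Qed.

Section ConsensusCriterion.
Context {R : realType} {n : nat}.
Variables (E : rel 'I_n) (p w : 'I_n -> 'I_n -> R).
Hypothesis E_loopless : forall i : 'I_n, ~~ E i i.
Hypothesis p_bounds : forall i j : 'I_n, E j i -> 0 < p i j < 1.
Hypothesis p_sum1 : \sum_(e : 'I_n * 'I_n | E e.1 e.2) p e.2 e.1 = 1.
Hypothesis w_bounds : forall i j : 'I_n, E j i -> 0 < w i j < 1.
Local Notation P := (edge_prob E p).

Lemma edge_prob_gt0 e : (0 < P e) = E e.1 e.2.
Proof.
by rewrite /edge_prob; case: ifP => [/p_bounds/andP[->]|]//; rewrite ltxx.
Qed.

Lemma edge_prob_ge0 e : 0 <= P e.
Proof. by rewrite /edge_prob; case: ifP => // /p_bounds/andP[/ltW]. Qed.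

Lemma edge_prob_sum1 : \sum_e P e = 1.
Proof. by rewrite -p_sum1 [RHS]big_mkcond. Qed.

Lemma edge_prob_loopless e : 0 < P e -> e.1 != e.2.
Proof. by rewrite edge_prob_gt0; apply: contraTneq => ->. Qed.

Definition deviation (a : R) (st : state R n) : R :=
  sqnorm (fun l => st.1 l - a) + sqnorm st.2.

Lemma sum_recenter_xavg (x0 : 'I_n -> R) : (0 < n)%N ->
  \sum_l (x0 l - xavg x0) = 0.
Proof.
move=> n_gt0; rewrite sumrB sumr_const card_ord -mulr_natr divfK ?subrr//.
by rewrite pnatr_eq0 -lt0n.
Qed.

Lemma strongly_connected_deviation_cvg0 : strongly_connected E ->
  exists2 epsb : R, 0 < epsb & forall eps x0, 0 < eps < epsb ->
  ((fun k => gossip_expect E p w eps x0 k (deviation (xavg x0))) @ \oo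
     --> (0 : R))%classic.
Proof.
move=> E_connected.
have P_connected a b : connect (fun j i => 0 < P (j, i)) a b.
  by rewrite (eq_connect (e' := E)) ?E_connected// => j i; rewrite edge_prob_gt0.
have wP_bounds e : 0 < P e -> 0 < w e.2 e.1 < 1.
  by rewrite edge_prob_gt0; exact: w_bounds.
have [epsb epsb_gt0 lyapunov] := gossip_lyapunov edge_prob_ge0 edge_prob_sum1
  edge_prob_loopless P_connected wP_bounds.
exists epsb => // eps x0 /lyapunov[V [c c_gt0 [V_ge0 V_drift]]].
have [e0 _] := exists_weight_gt0 edge_prob_ge0 edge_prob_sum1.
have n_gt0 : (0 < n)%N := leq_ltn_trans (leq0n _) (ltn_ord e0.1).
pose balanced (st : state R n) :=
  let st' := recenter (xavg x0) st in \sum_l st'.1 l + \sum_l st'.2 l = 0.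
have balanced0 : balanced (x0, fun=> 0).
  by rewrite /balanced /= sum_recenter_xavg// big1 ?addr0.
under eq_fun do rewrite gossip_expect_iter.
apply: (foster_lyapunov_cvg0 (V := V \o recenter (xavg x0)) (c := c) edge_prob_ge0
  edge_prob_sum1 _ balanced0) => //.
- move=> e st /edge_prob_loopless ne; rewrite /balanced -gossip_step_recenter.
  by rewrite sum_gossip_step.
- by move=> st; exact: V_ge0.
- by move=> st; rewrite /deviation addr_ge0// sum_sqr_ge0.
- move=> st /V_drift; rewrite /markov_op /=.
  by under eq_mean do rewrite gossip_step_recenter.
Qed.

Lemma deviation_cvg0_consensus eps :
  (forall x0, (fun k => gossip_expect E p w eps x0 k (deviation (xavg x0))) @ \oo
     --> (0 : R))%classic ->
  ms_average_consensus E p w eps.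
Proof.
move=> dev_cvg0 x0.
have dominated f : (forall st, 0 <= f st <= deviation (xavg x0) st) ->
    ((fun k => gossip_expect E p w eps x0 k f) @ \oo --> (0 : R))%classic.
  move=> f_bounds; apply: (squeeze_cvgr _ (cvg_cst 0) (dev_cvg0 x0)).
  apply: nearW => k; rewrite !gossip_expect_iter; apply/andP; split.
    apply: (iter_markov_op_ge0 _ edge_prob_ge0 edge_prob_sum1) => st.
    by have /andP[] := f_bounds st.
  by apply: (ler_iter_markov_op _ edge_prob_ge0) => st; have /andP[] := f_bounds st.
split; apply: dominated => st; rewrite sum_sqr_ge0 /deviation /=.
  by rewrite lerDl sum_sqr_ge0.
by rewrite lerDr sum_sqr_ge0.
Qed.

Definition confined u (st : state R n) :=
  forall l, ~~ connect E u l -> st.1 l = 0 /\ st.2 l = 0.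

Lemma confined_step eps u e st :
  0 < P e -> confined u st -> confined u (gossip_step w eps e st).
Proof.
rewrite edge_prob_gt0 => Ee st_confined l ul; rewrite /=; case: eqP => [le|_].
  have [xl sl] := st_confined l ul; rewrite -le xl sl.
  have [|-> ->] := st_confined e.1; last by split; ring.
  by apply: contra ul => ue; rewrite le (connect_trans ue (connect1 Ee)).
by have [-> ->] := st_confined l ul; split=> //; case: ifP.
Qed.

Lemma consensus_strongly_connected eps :
  ms_average_consensus E p w eps -> strongly_connected E.
Proof.
move=> consensus u v; apply: contraT => uv.
pose x0 l : R := (connect E u l)%:R.
have [+ _] := consensus x0; set a := xavg x0 => cvg0.
have confined0 : confined u (x0, fun=> 0) by move=> l /negbTE ul; rewrite /= /x0 ul.
have n_gt0 : (0 < n)%N := leq_ltn_trans (leq0n _) (ltn_ord u).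
have a_gt0 : 0 < a.
  rewrite divr_gt0 ?ltr0n// (bigD1 u)//= /x0 connect0 ltr_pwDl// sumr_ge0//.
have : a ^+ 2 <= 0.
  apply: (cvgr_to_ge cvg0); apply: nearW => k; rewrite gossip_expect_iter.
  rewrite -[leLHS](iter_markov_op_cst (gossip_step w eps) edge_prob_sum1 k _
    (x0, fun=> 0)).
  apply: (ler_iter_markov_op_on edge_prob_ge0 _ (@confined_step eps u)) => //.
  move=> st st_confined.
  rewrite /sqnorm (bigD1 v)//=; have [-> _] := st_confined v uv.
  by rewrite sub0r sqrrN lerDl sumr_ge0// => l _; exact: sqr_ge0.
by rewrite leNgt exprn_gt0.
Qed.

End ConsensusCriterion.

Theorem theorem2 (R : realType) (n : nat) (E : rel 'I_n)
    (p w : 'I_n -> 'I_n -> R) :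
  (1 < n)%N ->
  (forall i : 'I_n, ~~ E i i) ->
  (forall i j : 'I_n, E j i -> 0 < p i j < 1) ->
  (\sum_(e : 'I_n * 'I_n | E e.1 e.2) p e.2 e.1 = 1) ->
  (forall i j : 'I_n, E j i -> 0 < w i j < 1) ->
  (strongly_connected E <->
   exists epsb : R, 0 < epsb /\
     forall eps : R, 0 < eps < epsb -> ms_average_consensus E p w eps).
Proof.
move=> _ E_loopless p_bounds p_sum1 w_bounds; split=> [E_connected|].
  have [epsb epsb_gt0 deviation_cvg0] := strongly_connected_deviation_cvg0
    E_loopless p_bounds p_sum1 w_bounds E_connected.
  exists epsb; split=> // eps eps_bounds.
  apply: (deviation_cvg0_consensus p_bounds p_sum1) => x0.
  exact: deviation_cvg0.
move=> [epsb [epsb_gt0 consensus]].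
apply: (consensus_strongly_connected (w := w) (eps := epsb / 2) p_bounds p_sum1).
by apply: consensus; lra.
Qed.
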